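(* There is a $2$-DFAO with $29$ states that, for every $n \geq 1$, on input $(n)_2$ returns the circular critical exponent $\mathrm{cce}(\mathbf{t}[0..n-1])$ of the prefix of length $n$ of the Thue-Morse word $\mathbf{t}$.
   Context: The Thue-Morse word $\mathbf{t} = t_0 t_1 t_2 \cdots = 01101001\cdots$ is the infinite fixed point, starting with $0$, of the morphism $\mu$ with $\mu(0)=01$, $\mu(1)=10$. The notation $\mathbf{t}[i..j]$ means $t_i t_{i+1}\cdots t_j$. A nonempty finite word $w$ (indexed from $0$) has period $p$, where $1 \le p \le |w|$, if $w[i]=w[i+p]$ for all $i$ with $0 \le i < |w|-p$. The smallest period of $w$ is denoted $p(w)$, and the exponent of $w$ is $\exp(w) = |w|/p(w)$. A factor of a word is a contiguous block inside it. The conjugates of a finite word $w$ are its cyclic shifts, i.e. the words $yx$ with $w = xy$ ($x,y$ possibly empty). The circular critical exponent $\mathrm{cce}(w)$ of a nonempty finite word $w$ is the supremum (maximum) of $\exp(x)$ over all nonempty factors $x$ of all conjugates of $w$. A $k$-DFAO (deterministic finite automaton with output) is $M=(Q,\Sigma_k,\delta,q_0,\Delta,\tau)$, where $Q$ is a finite nonempty set of states, $\Sigma_k=\{0,1,\ldots,k-1\}$ is the input alphabet, $\delta:Q\times\Sigma_k\to Q$ is the transition function (extended to $Q\times\Sigma_k^*$ in the usual way), $q_0\in Q$ is the initial state, $\Delta$ is the (finite) output alphabet (here a finite set of rational numbers), and $\tau:Q\to\Delta$ is the output map. On input $x \in \Sigma_k^*$ it returns $\tau(\delta(q_0,x))$.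 $(n)_2$ denotes the base-$2$ representation of $n$, read starting with the most significant digit. *)

(* Defs.v *)
From mathcomp Require Import all_boot all_order all_algebra.
From mathcomp Require Import finmap.
Set Implicit Arguments.
Unset Strict Implicit.
Unset Printing Implicit Defensive.
Import Order.TTheory GRing.Theory Num.Theory.

Section Words.
Variable T : eqType.
Implicit Types (w x : seq T) (p : nat).
Local Open Scope nat_scope.

(* [onth] avoids a default letter: both sides are [Some _] for these [i]. *)
Definition has_period w p : bool :=
  (1 <= p <= size w) &&
  [forall i : 'I_(size w - p), onth w i == onth w (i + p)].

(* A nonempty [w] has period [size w], so starting the minimum at [size w] does
   not affect its value. *)
Definition least_period w : nat :=
  \big[minn/size w]_(1 <= p < (size w).+1 | has_period w p) p.

Definition exponent w : rat := ((size w)%:R / (least_period w)%:R)%R.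

(* [rot i w] is [y ++ x] for [w = x ++ y] with [size x = i]. *)
Definition conjugates w : seq (seq T) :=
  [seq rot i w | i <- iota 0 (size w).+1].

Definition factors w : seq (seq T) :=
  [seq take l (drop i w) | i <- iota 0 (size w).+1, l <- iota 0 (size w).+1].

(* Exponents of nonempty words are positive, so the default value [0] plays no
   role when [w] is nonempty; see [cce_max]. *)
Definition cce w : rat :=
  \big[Num.max/0%R]_(x <- flatten (map factors (conjugates w)) | x != [::])
     exponent x.

Lemma conjugatesP w y :
  reflect (exists u v, w = u ++ v /\ y = v ++ u) (y \in conjugates w).
Proof.
apply: (iffP mapP) => [[i _ ->]|[u [v [-> ->]]]].
  by exists (take i w), (drop i w); rewrite cat_take_drop.
exists (size u); last by rewrite rot_size_cat.
by rewrite mem_iota size_cat /= add0n ltnS leq_addr.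
Qed.

Lemma factorsP w x : reflect (exists u v, w = u ++ x ++ v) (x \in factors w).
Proof.
apply: (iffP allpairsP) => [[[i l] [_ _ ->]] /=|[u [v ->]]].
  by exists (take i w), (drop l (drop i w)); rewrite !cat_take_drop.
exists (size u, size x); rewrite !mem_iota !size_cat /= !add0n !ltnS.
by rewrite leq_addr drop_size_cat // take_size_cat // addnCA leq_addr.
Qed.

Lemma least_periodP w : w != [::] ->
  has_period w (least_period w) /\
  forall p, has_period w p -> least_period w <= p.
Proof.
move=> w0; have sw : 0 < size w by rewrite lt0n size_eq0.
have per_size : has_period w (size w).
  by rewrite /has_period sw leqnn /=; apply/forallP; rewrite subnn => -[].
split.
  rewrite /least_period; elim/big_ind: _ => // m n hm hn.
  by rewrite /minn; case: ifP.
move=> p hp; rewrite /least_period.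
have : p \in index_iota 1 (size w).+1.
  by rewrite mem_index_iota ltnS; case/andP: hp.
elim: (index_iota _ _) => // q s IH; rewrite inE big_cons => /orP[/eqP<-|ps].
  by rewrite hp geq_minl.
by case: ifP => _; [apply: leq_trans (geq_minr _ _) _|]; apply: IH.
Qed.

Lemma cce_max w : w != [::] ->
  (exists y x, [/\ y \in conjugates w, x \in factors y, x != [::]
                 & cce w = exponent x]) /\
  (forall y x, y \in conjugates w -> x \in factors y -> x != [::] ->
     (exponent x <= cce w)%R).
Proof.
move=> w0; set s := flatten (map factors (conjugates w)).
have sP x : reflect (exists2 y, y \in conjugates w & x \in factors y) (x \in s).
  exact: flatten_mapP.
have ub x : x \in s -> x != [::] -> (exponent x <= cce w)%R.
  by move=> xs x0; apply: (le_bigmax_seq 0%R) xs x0.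
split; last by move=> y x yw xy; apply: ub; apply/sP; exists y.
have ws : w \in s.
  apply/sP; exists w; first by apply/conjugatesP; exists [::], w; rewrite cats0.
  by apply/factorsP; exists [::], [::]; rewrite cats0.
have cce_gt0 : (0 < cce w)%R.
  apply: lt_le_trans (ub _ ws w0); have [/andP[/andP[p0 _] _] _] := least_periodP w0.
  by rewrite divr_gt0 // ltr0n // lt0n size_eq0.
have: cce w = 0%R \/ exists x, [/\ x \in s, x != [::] & cce w = exponent x].
  rewrite /cce -/s; elim: (s) => [|x r IH]; first by left; rewrite big_nil.
  rewrite big_cons; case: ifP => x0; last first.
    by case: IH => [|[z [zr z0 e]]]; [left|right; exists z; rewrite inE zr orbT].
  rewrite /Num.max; case: ifP => _.
    by case: IH => [|[z [zr z0 e]]]; [left|right; exists z; rewrite inE zr orbT].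
  by right; exists x; rewrite inE eqxx.
case=> [e0|[x [/sP[y yw xy] x0 e]]]; first by rewrite e0 ltxx in cce_gt0.
by exists y, x.
Qed.

End Words.

(* Letters: [false] is 0 and [true] is 1. *)
Definition mu_letter (a : bool) : seq bool :=
  if a then [:: true; false] else [:: false; true].

Definition mu (w : seq bool) : seq bool := flatten (map mu_letter w).

(* The words [mu^m(0)] are prefixes of one another with [size = 2 ^ m], so the
   [n]-th letter of their limit can be read off [mu^n(0)]; see
   [thue_morse_fixed]. *)
Definition thue_morse (n : nat) : bool := nth false (iter n mu [:: false]) n.

Definition thue_morse_prefix (n : nat) : seq bool := mkseq thue_morse n.

Lemma size_mu w : size (mu w) = (size w).*2.
Proof. by rewrite /mu; elim: w => //= -[] w IH; rewrite /= IH. Qed.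

Lemma mu_cat v w : mu (v ++ w) = mu v ++ mu w.
Proof. by rewrite /mu map_cat flatten_cat. Qed.

Lemma thue_morse_iter m : iter m mu [:: false] = thue_morse_prefix (2 ^ m).
Proof.
have sz k : size (iter k mu [:: false]) = 2 ^ k.
  by elim: k => [//|k IH]; rewrite iterS size_mu IH expnS mul2n.
have step k : exists v, iter k.+1 mu [:: false] = iter k mu [:: false] ++ v.
  elim: k => [|k [v IH]]; first by exists [:: true].
  by exists (mu v); rewrite iterS [in LHS]IH mu_cat.
have ext k d : exists v, iter (d + k) mu [:: false] = iter k mu [:: false] ++ v.
  elim: d => [|d [v IH]]; first by exists [::]; rewrite cats0.
  have [u e] := step (d + k); exists (v ++ u).
  by rewrite addSn e IH catA.
apply: (@eq_from_nth _ false); rewrite sz ?size_mkseq // => i im.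
rewrite nth_mkseq // /thue_morse; case: (leqP i m) => h.
  have [v e] := ext i (m - i); rewrite subnK // in e.
  by rewrite e nth_cat sz ltn_expl.
have [v e] := ext m (i - m); rewrite subnK 1?ltnW // in e.
by rewrite e nth_cat sz im.
Qed.

Lemma thue_morse_fixed n :
  mu (thue_morse_prefix n) = thue_morse_prefix n.*2.
Proof.
have pre k l : k <= l -> thue_morse_prefix k = take k (thue_morse_prefix l).
  move=> kl; rewrite /thue_morse_prefix /mkseq -map_take take_iota.
  by rewrite (minn_idPl kl).
have take_mu (w : seq bool) k : take k.*2 (mu w) = mu (take k w).
  have [kw|/ltnW kw] := leqP k (size w); last first.
    by rewrite !take_oversize ?size_mu ?leq_double.
  rewrite -{1}(cat_take_drop k w) mu_cat take_size_cat //.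
  by rewrite size_mu size_takel.
have nl : n <= 2 ^ n by apply/ltnW/ltn_expl.
rewrite (pre n _ nl) -take_mu -thue_morse_iter -iterS thue_morse_iter.
by rewrite -pre // expnS mul2n leq_double.
Qed.

Record dfao (k : nat) (T : choiceType) := DFAO {
  dfao_state : finType;
  dfao_trans : dfao_state -> 'I_k -> dfao_state;
  dfao_init : dfao_state;
  dfao_alphabet : {fset T};
  dfao_out : dfao_state -> dfao_alphabet
}.

Definition dfao_run k T (M : dfao k T) (x : seq 'I_k) : dfao_state M :=
  foldl (@dfao_trans k T M) (dfao_init M) x.

Definition dfao_output k T (M : dfao k T) (x : seq 'I_k) : T :=
  val (dfao_out (dfao_run M x)).

(* Most significant digit first; [up_log 2 n.+1] is the number of binary digits
   of [n], so there is no leading zero and 0 is represented by the empty word. *)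
Definition binary (n : nat) : seq 'I_2 :=
  rev (mkseq (fun i => inord ((n %/ 2 ^ i) %% 2)) (up_log 2 n.+1)).

Lemma binary_head n : 0 < n -> ohead (binary n) = Some (inord 1).
Proof.
move=> n0; have n1 : 1 < n.+1 by [].
have := up_log_bounds (isT : 1 < 2) n1; have := up_log_gt0 2 n.+1.
rewrite n1 /binary; case: (up_log 2 n.+1) => // m _ /= /andP[lo hi].
rewrite mkseqS rev_rcons /=; congr (Some (inord _)).
suff -> : n %/ 2 ^ m = 1 by [].
apply/eqP; rewrite eqn_leq -ltnS ltn_divLR ?expn_gt0 // -expnS hi /=.
by rewrite divn_gt0 ?expn_gt0.
Qed.

Lemma binary_value n : foldl (fun v (d : 'I_2) => v.*2 + d) 0 (binary n) = n.
Proof.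
have: n < 2 ^ up_log 2 n.+1 by apply: up_logP.
rewrite /binary foldl_rev; move: (up_log 2 n.+1) => m.
elim: m n => [|m IH] k; first by rewrite expn0 ltnS leqn0 => /eqP->.
rewrite expnS => kl; rewrite /mkseq /= expn0 divn1 (iotaDl 1 0) -map_comp.
rewrite inordK ?ltn_pmod //.
rewrite (@eq_map _ _ _ (fun i => inord (((k %/ 2) %/ 2 ^ i) %% 2))); last first.
  by move=> i /=; rewrite add1n expnS divnMA.
have kl' : k %/ 2 < 2 ^ m by rewrite ltn_divLR // mulnC.
by rewrite [foldr _ _ _](IH _ kl') -muln2 -divn_eq.
Qed.

(* Main.v *)
Require Import Defs.
From mathcomp Require Import all_boot all_order all_algebra.
From mathcomp Require Import finmap zify.

Set Implicit Arguments.
Unset Strict Implicit.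
Unset Printing Implicit Defensive.
Import Order.TTheory GRing.Theory Num.Theory.

(* If cce(w) >= 2 then cce(mu(w)) = cce(w): in mu(w) equal adjacent letters
   straddle two blocks, so an odd period admits no factor of exponent > 2, and an
   even period descends to w.  Hence cce(t[0..2n-1]) = cce(t[0..n-1]) for n >= 3.
   For n odd, the block boundaries on the two sides of the junction of
   t[0..n-1] with itself have different parities, which bounds the length of a
   factor of period p > 4 across the junction by 2p + 6.  As cce >= 7/3 for large odd
   n, only p <= 17 matters, and cce(t[0..n-1]) is read off a bounded window around
   the junction.  That window depends only on the last five bits of n and on two
   letters of t, so the output is verified on the finitely many reachable
   configurations of the automaton. *)

(** * Exponents as runs in periodic infinite words *)

Definition ratio (r : nat * nat) : rat := (r.1%:R / r.2%:R)%R.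

Lemma ler_ratio l p m q : 0 < p -> 0 < q ->
  (ratio (l, p) <= ratio (m, q))%R = (l * q <= m * p).
Proof.
move=> p0 q0; rewrite /ratio /= ler_pdivrMr ?ltr0n // mulrAC.
by rewrite ler_pdivlMr ?ltr0n // -!natrM ler_nat.
Qed.

Definition run (T : Type) (c : nat -> T) i p l :=
  forall j, j + p < l -> c (i + j) = c (i + j + p).

Section Circular.
Variables (T : eqType) (x0 : T).
Implicit Type w : seq T.

(** The infinite repetition of [w]: its factors of length at most [size w] are exactly the factors
    of the conjugates of [w]. *)
Definition circ w i := nth x0 w (i %% size w).

Lemma circ_small w i : i < size w -> circ w i = nth x0 w i.
Proof. by move=> h; rewrite /circ modn_small. Qed.

Lemma circ_modl w i j : circ w (i %% size w + j) = circ w (i + j).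
Proof. by rewrite /circ modnDml. Qed.

Lemma nth_rot w i j : i <= size w -> j < size w ->
  nth x0 (rot i w) j = circ w (i + j).
Proof.
move=> iw jw; rewrite /rot nth_cat size_drop nth_drop /circ.
case: ltnP => h; first by rewrite modn_small //; lia.
rewrite nth_take; last by lia.
have -> : i + j = (j - (size w - i)) + size w by lia.
by rewrite modnDr modn_small //; lia.
Qed.

Lemma has_periodP w p :
  reflect (1 <= p <= size w /\ run (nth x0 w) 0 p (size w)) (has_period w p).
Proof.
apply: (iffP andP) => -[hp h]; split=> //.
  move=> j jw; have jlt : j < size w - p by lia.
  move/forallP: h => /(_ (Ordinal jlt))/eqP /=.
  by rewrite !onthE !(nth_map x0); [case|lia..].
apply/forallP => -[j jw]; apply/eqP => /=.
rewrite !onthE !(nth_map x0); [|lia..].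
by congr Some; apply: h; lia.
Qed.

Lemma exponent_ge w p : has_period w p -> (ratio (size w, p) <= exponent w)%R.
Proof.
move=> h; have [/andP[p0 pw] _] := has_periodP _ _ h.
have w0 : w != [::] by rewrite -size_eq0; lia.
have [/has_periodP[/andP[q0 _] _] /(_ _ h) qp] := least_periodP w0.
by rewrite ler_ratio // leq_mul2l qp orbT.
Qed.

Lemma cce_ge w i p l : 0 < p <= l -> l <= size w -> run (circ w) i p l ->
  (ratio (l, p) <= cce w)%R.
Proof.
move=> /andP[p0 pl] lw h.
have w0 : w != [::] by rewrite -size_eq0; lia.
have sw : 0 < size w by lia.
set y := rot (i %% size w) w; set x := take l y.
have sx : size x = l by rewrite size_takel // size_rot.
have [_ ub] := cce_max w0.
apply: le_trans (ub y x _ _ _); last 3 first.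
- by apply/mapP; exists (i %% size w); rewrite // mem_iota /= ltnW // ltnS ltn_pmod.
- by apply/factorsP; exists [::], (drop l y); rewrite cat_take_drop.
- by rewrite -size_eq0 sx; lia.
rewrite -{1}sx; apply/exponent_ge/has_periodP; rewrite sx; split; first lia.
move=> j jl; rewrite !add0n !nth_take; [|lia..].
rewrite !nth_rot ?addnA ?circ_modl; [|by rewrite ?(ltnW (ltn_pmod _ sw)) //; lia..].
by rewrite -addnA circ_modl addnA; apply: h.
Qed.

Lemma cce_attained w : w != [::] -> exists i p l,
  [/\ i < size w, 0 < p <= l, l <= size w, run (circ w) i p l &
      cce w = ratio (l, p)].
Proof.
move=> w0; have sw : 0 < size w by rewrite lt0n size_eq0.
have [[y [x [/mapP[i]]]]] := cce_max w0.
rewrite mem_iota /= add0n ltnS => iw -> /allpairsP[[k l] /= [_ _ ->]] xn0 -> _.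
set x' := take l _ in xn0 *.
have [/has_periodP[hp hr] _] := least_periodP xn0.
have sx : size x' <= size w - k.
  by rewrite /x' size_take size_drop size_rot; case: ltnP; lia.
exists ((i + k) %% size w), (least_period x'), (size x'); split=> //.
- by rewrite ltn_pmod.
- by lia.
move=> j jl; have := hr _ jl; rewrite !add0n.
have sl : size x' <= l by rewrite /x' size_take; case: ltnP; lia.
rewrite !nth_take ?nth_drop; [|lia..].
by rewrite !nth_rot; [|lia..]; rewrite -addnA !circ_modl !addnA.
Qed.

Lemma cce_eq w i p l r : 0 < p <= l -> l <= size w -> run (circ w) i p l ->
  ratio (l, p) = ratio r ->
  (forall i p l, i < size w -> 0 < p <= l -> l <= size w ->
     run (circ w) i p l -> (ratio (l, p) <= ratio r)%R) ->
  cce w = ratio r.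
Proof.
move=> pl lw h e ub; apply/eqP; rewrite eq_le -{2}e (cce_ge pl lw h) andbT.
have w0 : w != [::] by rewrite -size_eq0; lia.
by have [i' [p' [l' [h1 h2 h3 h4 ->]]]] := cce_attained w0; apply: ub h4.
Qed.

End Circular.

(** * Effect of the morphism on periods *)

Definition mu_image (c d : nat -> bool) :=
  forall k, d k.*2 = c k /\ d k.*2.+1 = ~~ c k.

Lemma mu_image_pair c d k : mu_image c d -> d k = d k.+1 -> odd k.
Proof.
move=> h; case: (boolP (odd k)) => // ek.
have [] := h k./2; rewrite even_halfK // => -> -> /eqP.
by case: (c _).
Qed.

(* In an alternating stretch the letters at distance [p] odd differ, so some
   equal pair of adjacent letters occurs; equal pairs straddle two blocks of
   [mu], so they cannot recur at an odd distance. *)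
Lemma run_odd_period c d i p l : mu_image c d -> odd p -> run d i p l ->
  l <= p.*2.
Proof.
move=> h op r; rewrite leqNgt; apply/negP => lp.
have [j jp e] : exists2 j, j < p & d (i + j) = d (i + j).+1.
  case: (boolP [exists j : 'I_p, d (i + j) == d (i + j).+1]).
    by move=> /existsP[j /eqP e]; exists j.
  rewrite negb_exists => /forallP alt.
  have alt' j : j <= p -> d (i + j) = d i (+) odd j.
    elim: j => [|j IH] jp; first by rewrite addn0 addbF.
    have := alt (Ordinal jp); rewrite /= IH; last lia.
    by rewrite addnS; case: (d i); case: (odd j); case: (d _).
  have := r 0; rewrite addn0 alt' // op addbT => e.
  by have /= := e ltac:(lia); case: (d i).
have e2 : d (i + j + p) = d (i + j + p).+1.
  by rewrite -addSn -addnS -!r; [rewrite addnS|lia..].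
have := mu_image_pair h e; have := mu_image_pair h e2.
by rewrite oddD op; case: odd.
Qed.

(** Either letter of a block determines the block, so reading every other letter from [i] on
    recovers [uphalf l] letters of [c], whatever the parity of [i]. *)
Lemma run_half c d i q l : mu_image c d -> run d i q.*2 l ->
  run c i./2 q (uphalf l).
Proof.
move=> h r j jl; have [h0 h1] := (h (i./2 + j), h (i./2 + j + q)).
case: (boolP (odd i)) => oi.
  have := r j.*2; have -> : i + j.*2 = (i./2 + j).*2.+1 by lia.
  rewrite h0.2 (_ : _.+1 + q.*2 = (i./2 + j + q).*2.+1) ?h1.2; last lia.
  by move=> /(_ _)/negb_inj -> //; lia.
have := r j.*2; have -> : i + j.*2 = (i./2 + j).*2 by lia.
rewrite (_ : (i./2 + j).*2 + q.*2 = (i./2 + j + q).*2) ?h0.1 ?h1.1; last lia.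
by move=> -> //; lia.
Qed.

Lemma run_double c d i p l : mu_image c d -> run c i p l ->
  run d i.*2 p.*2 l.*2.
Proof.
move=> h r j jl; have e := r j./2; have [h0 h1] := (h (i + j./2), h (i + j./2 + p)).
case: (boolP (odd j)) => oj.
  have -> : i.*2 + j = (i + j./2).*2.+1 by lia.
  rewrite h0.2 (_ : _ + p.*2 = (i + j./2 + p).*2.+1) ?h1.2; last lia.
  by rewrite e //; lia.
have -> : i.*2 + j = (i + j./2).*2 by lia.
rewrite (_ : (i + j./2).*2 + p.*2 = (i + j./2 + p).*2) ?h0.1 ?h1.1; last lia.
by rewrite e //; lia.
Qed.

Lemma nth_mu w k : k < size w ->
  nth false (mu w) k.*2 = nth false w k /\
  nth false (mu w) k.*2.+1 = ~~ nth false w k.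
Proof. by elim: w k => [|[] w IH] [|k] //= kw; have := IH k kw. Qed.

Lemma mu_image_circ w : w != [::] -> mu_image (circ false w) (circ false (mu w)).
Proof.
rewrite -size_eq0 -lt0n => w0 k; rewrite /circ size_mu.
have kw : k %% size w < size w by rewrite ltn_pmod.
set r := k %% size w in kw *.
have e : k.*2 %% (size w).*2 = r.*2 by rewrite -!muln2 -muln_modl.
have -> : k.*2.+1 %% (size w).*2 = r.*2.+1.
  by rewrite -addn1 -modnDml e modn_small; lia.
by rewrite e; apply: nth_mu.
Qed.

Lemma cce_mu w : w != [::] -> (2%:R <= cce w)%R -> cce (mu w) = cce w.
Proof.
move=> w0 w2; have h := mu_image_circ w0.
have mw0 : mu w != [::] by rewrite -size_eq0 size_mu double_eq0 size_eq0.
apply/eqP; rewrite eq_le; apply/andP; split.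
  have [i [p [l [_ pl lw r ->]]]] := cce_attained false mw0.
  rewrite size_mu in lw; case: (boolP (odd p)) => [op|ep].
    have lp := run_odd_period h op r.
    apply: le_trans w2; rewrite -[2%:R%R](divr1 2%:R%R).
    by rewrite (_ : _ / 1 = ratio (2, 1))%R // ler_ratio //; lia.
  have r' : run (circ false w) i./2 p./2 (uphalf l).
    by apply: run_half h _; rewrite even_halfK.
  have pl' : 0 < p./2 <= uphalf l by lia.
  have lw' : uphalf l <= size w by rewrite leq_uphalf_double.
  apply: le_trans (cce_ge pl' lw' r').
  have -> : p = p./2.*2 by rewrite even_halfK.
  by rewrite doubleK ler_ratio; nia.
have [i [p [l [_ pl lw r ->]]]] := cce_attained false w0.
have r' := run_double h r.
have pl' : 0 < p.*2 <= l.*2 by lia.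
have lw' : l.*2 <= size (mu w) by rewrite size_mu leq_double.
by apply: le_trans (cce_ge pl' lw' r'); rewrite ler_ratio; lia.
Qed.

(** * Overlap-freeness of the Thue-Morse word *)

Lemma size_thue_morse_prefix n : size (thue_morse_prefix n) = n.
Proof. exact: size_mkseq. Qed.

Lemma mu_image_thue_morse : mu_image thue_morse thue_morse.
Proof.
move=> k; have := @nth_mu (thue_morse_prefix k.+1) k.
by rewrite thue_morse_fixed size_mkseq !nth_mkseq //; [apply|lia..].
Qed.

(** Descent on the period: since [t = mu(t)], an even period halves within [t] itself, until an odd
    one is reached. *)
Lemma thue_morse_overlap_free i p l : 0 < p -> run thue_morse i p l -> l <= p.*2.
Proof.
elim/ltn_ind: p i l => p IH i l p0 r; have h := mu_image_thue_morse.
case: (boolP (odd p)) => [op|ep]; first exact: run_odd_period h op r.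
have := IH p./2 _ i./2 (uphalf l) _ (run_half h _).
by rewrite even_halfK // => H; have := H ltac:(lia) ltac:(lia) r; lia.
Qed.

(** Otherwise five consecutive letters alternate, which is an overlap of period 2. *)
Lemma thue_morse_pair i :
  exists2 j, j < 4 & thue_morse (i + j) = thue_morse (i + j).+1.
Proof.
case: (boolP [exists j : 'I_4, thue_morse (i + j) == thue_morse (i + j).+1]).
  by move=> /existsP[j /eqP e]; exists j.
rewrite negb_exists => /forallP alt.
suff : 5 <= 2.*2 by [].
apply: (@thue_morse_overlap_free i) => // j j5.
have jlt : j < 4 by lia.
have j'lt : j.+1 < 4 by lia.
have := alt (Ordinal jlt); have := alt (Ordinal j'lt).
by rewrite /= addn2 !addnS; do 3!case: (thue_morse _).
Qed.

Lemma run_sub (T : Type) (c : nat -> T) i p l k l' :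
  i <= k -> k + l' <= i + l -> run c i p l -> run c k p l'.
Proof.
move=> ik kl r j jl; have := r (k - i + j).
by rewrite addnA subnKC //; apply; lia.
Qed.

(** * Runs across the junction of two copies of a prefix *)

Lemma circ_thue_morse_left n k : k < n ->
  circ false (thue_morse_prefix n) k = thue_morse k.
Proof. by move=> kn; rewrite circ_small ?size_thue_morse_prefix // nth_mkseq. Qed.

Lemma circ_thue_morse_right n k : k < n ->
  circ false (thue_morse_prefix n) (n + k) = thue_morse k.
Proof.
by move=> kn; rewrite /circ size_thue_morse_prefix modnDl modn_small // nth_mkseq.
Qed.

Lemma circ_thue_morse_run n i p l : 0 < p ->
  i + l <= n \/ n <= i /\ i + l <= n + n ->
  run (circ false (thue_morse_prefix n)) i p l -> l <= p.*2.
Proof.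
move=> p0 [il|[ni il]] r.
  apply: (@thue_morse_overlap_free i) => // j jl.
  by rewrite -!(@circ_thue_morse_left n) ?r //; lia.
apply: (@thue_morse_overlap_free (i - n)) => // j jl.
rewrite -!(@circ_thue_morse_right n) ?addnA ?subnKC ?r //; lia.
Qed.

(* Across the junction of [t[0..n-1] t[0..n-1]] with [n] odd the parity of the
   block boundaries changes, so equal adjacent letters on different sides can
   match only at odd distance, those on the same side only at even distance. *)
Lemma odd_junction_run n i p l : odd n -> i < n < i + l -> l <= n -> 4 < p ->
  run (circ false (thue_morse_prefix n)) i p l ->
  l <= p.*2 + 4 \/ n - i <= p + 4 /\ i + l - n <= p + 2.
Proof.
move=> on /andP[lin nil] ln p4 r; have [//|lbig] := leqP l (p.*2 + 4); first by left.
set c := circ _ _ in r.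
have cl k : k < n -> c k = thue_morse k by apply: circ_thue_morse_left.
have cr k : k < n -> c (n + k) = thue_morse k by apply: circ_thue_morse_right.
have h := mu_image_thue_morse.
have pl k : c k = c k.+1 -> k.+1 < n -> odd k.
  by move=> e kn; move: e; rewrite !cl //; [apply: mu_image_pair|lia].
have pr k : c (n + k) = c (n + k).+1 -> k.+1 < n -> odd k.
  by move=> e kn; move: e; rewrite -addnS !cr //; [apply: mu_image_pair|lia].
have shift k : i <= k -> k.+1 + p < i + l -> c k = c k.+1 <-> c (k + p) = c (k + p).+1.
  move=> ik kl; rewrite -addSn.
  have e1 : c k = c (k + p) by have := r (k - i); rewrite subnKC //; apply; lia.
  have e2 : c k.+1 = c (k.+1 + p).
    by have := r (k.+1 - i); rewrite subnKC; [apply|]; lia.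
  by rewrite e1 e2.
have u2 : n - i <= p.*2.
  by apply: circ_thue_morse_run (run_sub _ _ r); [..|exact: leqnn|]; lia.
have v2 : i + l - n <= p.*2.
  by apply: (@circ_thue_morse_run n n _ _ _ _ (run_sub _ _ r)); lia.
(* The pair [t_1 t_2 = 11] is always present just right of the junction. *)
have t12 : c (n + 1) = c (n + 1).+1 by rewrite -addnS !cr //; lia.
(* [F2] and [F3] keep a pair and its shift on one side of the junction; [F4] moves [t_1 t_2] from
   the right side to the left. *)
have F2 : p + 3 <= i + l - n -> ~~ odd p.
  move=> hv; have := t12; rewrite shift; [|lia..].
  by rewrite -addnA => /pr; lia.
have F3 : p + 5 <= n - i -> ~~ odd p.
  move=> hu; have [j j4] := thue_morse_pair i.
  rewrite -!cl; [|lia..] => e; have := e; rewrite shift; [|lia..].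
  by move=> /pl; move: (pl _ e); lia.
have F4 : p <= (n - i).+1 -> odd p.
  move=> hu; have := t12.
  have -> : n + 1 = (n + 1 - p) + p by lia.
  by rewrite -shift; [|lia..] => /pl; lia.
(* If the left part has length at least [p - 1], then [p] is odd, and [F2] and [F3] bound both
   sides. *)
have [hu|hu] := leqP p (n - i).+1; first by have := F4 hu; lia.
(* Otherwise the right part exceeds [p + 5], so [p] is even by [F2]; but a pair among the last five
   letters before the junction moves across it, forcing [p] odd. *)
have [j j4] := thue_morse_pair (n - 5).
rewrite -!cl; [|lia..] => e; have := e; rewrite shift; [|lia..].
have -> : n - 5 + j + p = n + (p + j - 5) by lia.
by move=> /pr; move: (pl _ e); lia.
Qed.

(** * Computing maximal exponents in a finite window *)

Fixpoint lcp (v w : seq bool) : nat :=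
  match v, w with
  | a :: v', b :: w' => if a == b then (lcp v' w').+1 else 0
  | _, _ => 0
  end.

Lemma leq_lcp v w k : (k <= lcp v w) <->
  [/\ k <= size v, k <= size w & forall j, j < k -> nth false v j = nth false w j].
Proof.
elim: v w k => [|a v IH] [|b w] [|k] //=; split=> //; try by case.
  case: eqP => // <- /IH[h1 h2 h3]; split=> // -[|j] //; exact: h3.
case=> h1 h2 h; have /= -> := h 0 isT; rewrite eqxx ltnS; apply/IH; split=> // j jk.
exact: (h j.+1).
Qed.

Fixpoint max_lcp (v w : seq bool) : nat :=
  match v, w with
  | _ :: v', _ :: w' => maxn (lcp v w) (max_lcp v' w')
  | _, _ => 0
  end.

Lemma leq_max_lcp v w s : lcp (drop s v) (drop s w) <= max_lcp v w.
Proof.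
elim: s v w => [|s IH] [|a v] [|b w] //=.
- by rewrite leq_max leqnn.
- by case: (drop _ _).
- by rewrite leq_max IH orbT.
Qed.

Lemma max_lcp_attained v w : exists2 s, s <= minn (size v) (size w) &
  max_lcp v w = lcp (drop s v) (drop s w).
Proof.
elim: v w => [|a v IH] [|b w]; try by exists 0; rewrite ?drop0 //; case: v {IH}.
have [s sm e] := IH w; rewrite [max_lcp _ _]/= -/(lcp (a :: v) (b :: w)) /maxn.
case: ifP => _; last by exists 0; rewrite ?drop0.
by exists s.+1; rewrite //= minnSS.
Qed.

(* Length, capped at [N], of the longest factor of [w] having period [p]. *)
Definition max_run w N p := minn (max_lcp w (drop p w) + p) N.

(** Such a run is a common prefix of length [l - p] of the suffixes of [w] at [s] and [s + p]. *)
Lemma leq_max_run w N s p l : p <= l -> l <= N -> s + l <= size w ->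
  run (nth false w) s p l -> l <= max_run w N p.
Proof.
move=> pl lN sl h; rewrite /max_run leq_min lN andbT addnC -leq_subLR.
apply: leq_trans (leq_max_lcp _ _ s); rewrite drop_drop; apply/leq_lcp.
rewrite !size_drop; split; [lia..|] => j jl.
rewrite !nth_drop; have -> := h j ltac:(lia).
by congr nth; lia.
Qed.

Lemma max_run_attained w N p : p <= size w -> exists2 s,
  s + max_run w N p <= size w & run (nth false w) s p (max_run w N p).
Proof.
move=> pw; have [s] := max_lcp_attained w (drop p w).
rewrite /max_run drop_drop size_drop => sm ->.
have /leq_lcp[_] := leqnn (lcp (drop s w) (drop (s + p) w)).
rewrite size_drop => hs h; exists s; first lia.
by move=> j jl; have := h j; rewrite !nth_drop addnAC; apply; lia.
Qed.

Definition max_exponent_is w P N (r : nat * nat) :=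
  all (fun p => max_run w N p * r.2 <= r.1 * p) (iota 1 P) &&
  has (fun p => max_run w N p * r.2 == r.1 * p) (iota 1 P).

(** Reduces [cce w] to a computation on the window [v] at position [m]: a run not already bounded by
    [r] lies inside [v], and a run attaining [r] in [v] lifts back to [w]. *)
Lemma cce_window w m v P N r : 0 < r.2 -> P <= N -> N <= size w -> N <= size v ->
  (forall j, j < size v -> circ false w (m + j) = nth false v j) ->
  (forall i p l, i < size w -> 0 < p <= l -> l <= size w ->
     run (circ false w) i p l ->
     l * r.2 <= r.1 * p \/ [/\ p <= P, l <= N, m <= i & i + l <= m + size v]) ->
  max_exponent_is v P N r ->
  cce w = ratio r.
Proof.
case: r => a b /= b0 PN Nw Nv wv far /andP[/allP ub /hasP[p]].
rewrite mem_iota /= => hp /eqP e.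
have tr i q l : i + l <= size v ->
    run (nth false v) i q l <-> run (circ false w) (m + i) q l.
  move=> il; split=> h j jl.
    by rewrite -!addnA !wv ?addnA ?h //; lia.
  by have := h j jl; rewrite -!addnA !wv ?addnA //; lia.
have mN : max_run v N p <= N by rewrite geq_minr.
have pm : p <= max_run v N p by rewrite /max_run leq_min leq_addl; lia.
have [s sm h] := @max_run_attained v N p ltac:(lia).
apply: (@cce_eq _ false w (m + s) p (max_run v N p)).
- by lia.
- exact: leq_trans Nw.
- exact/tr.
- by apply/eqP; rewrite eq_le !ler_ratio ?e; lia.
move=> i q l iw hq lw h'; rewrite ler_ratio //; last lia.
have [//|[qP lN mi il]] := far i q l iw hq lw h'.
have := ub q; rewrite mem_iota => /(_ ltac:(lia)); apply: leq_trans.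
rewrite leq_mul2r (@leq_max_run _ _ (i - m)) ?orbT //; [lia|lia|].
by apply/tr; [lia|rewrite subnKC].
Qed.

(** * Thue-Morse blocks and binary digits *)

(** The block of length [2 ^ k] with index [a] is [mu^k(t_a)], which is [mu^k(0)] or its
    complement. *)
Lemma thue_morse_block k a j : j < 2 ^ k ->
  thue_morse (a * 2 ^ k + j) = thue_morse a (+) thue_morse j.
Proof.
have h := mu_image_thue_morse.
elim: k j => [|k IH] j; first by case: j => // _; rewrite expn0 muln1 addn0 addbF.
rewrite expnS => jk; have [h0 h1] := (h (a * 2 ^ k + j./2), h j./2).
have -> : a * (2 * 2 ^ k) + j = odd j + (a * 2 ^ k + j./2).*2.
  by rewrite -{1}(odd_double_half j) -!muln2; lia.
rewrite -{3}(odd_double_half j); case: (odd j); rewrite ![nat_of_bool _]/= ?(add1n, add0n).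
  by rewrite h0.2 h1.2 IH ?addbN //; lia.
by rewrite h0.1 h1.1 IH //; lia.
Qed.

(* Most significant bit first. *)
Definition append_bits a (s : seq bool) := foldl (fun v (b : bool) => b + v.*2) a s.

Lemma append_bitsE a s : append_bits a s = a * 2 ^ size s + append_bits 0 s.
Proof.
rewrite /append_bits; elim/last_ind: s => [|s b IH]; first by rewrite /= muln1 addn0.
by rewrite !foldl_rcons IH size_rcons expnS; lia.
Qed.

Lemma append_bits_lt s : append_bits 0 s < 2 ^ size s.
Proof.
rewrite /append_bits; elim/last_ind: s => [|s b IH] //.
by rewrite foldl_rcons size_rcons expnS; case: b; lia.
Qed.

Fixpoint bit_words k : seq (seq bool) :=
  if k is k'.+1 then
    [seq false :: s | s <- bit_words k'] ++ [seq true :: s | s <- bit_words k']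
  else [:: [::]].

Lemma mem_bit_words s : s \in bit_words (size s).
Proof.
elim: s => //= b s IH; rewrite mem_cat; apply/orP.
by case: b; [right|left]; apply: map_f.
Qed.

Lemma append_bits_split k n : 2 ^ k <= n ->
  exists a s, [/\ 0 < a, size s = k & n = append_bits a s].
Proof.
elim: k n => [|k IH] n; first by exists n, [::].
rewrite expnS => kn; have [|a [s [a0 sk e]]] := IH n./2; first lia.
exists a, (rcons s (odd n)); split; rewrite ?size_rcons ?sk //.
by rewrite /append_bits foldl_rcons -/(append_bits a s) -e odd_double_half.
Qed.

Lemma append_bits_one n : 0 < n -> exists2 s, n = append_bits 1 s & 2 ^ size s <= n.
Proof.
move=> n0; have [lo hi] := andP (trunc_log_bounds (isT : 1 < 2) n0).
have [a [s [a0 sk e]]] := append_bits_split lo.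
exists s; last by rewrite sk.
have := append_bitsE a s; rewrite -e sk => e'.
suff -> : 1 = a by [].
by move: hi e'; rewrite expnS; case: a a0 {e} => // -[|a] // _; nia.
Qed.

Lemma binary_rcons n (b : bool) : 0 < n ->
  binary (b + n.*2) = rcons (binary n) (inord b).
Proof.
move=> n0; rewrite /binary.
have -> : up_log 2 (b + n.*2).+1 = (up_log 2 n.+1).+1.
  have := up_log_bounds (isT : 1 < 2) (n0 : 1 < n.+1).
  case: (up_log 2 n.+1) => [|m] /= /andP[lo hi]; first by move: hi; rewrite expn0; lia.
  by apply: up_log_eq => //; rewrite !expnS in hi *; case: b; lia.
rewrite /mkseq /= rev_cons; congr rcons; last first.
  by congr inord; rewrite expn0 divn1; case: b; lia.
congr rev; rewrite (iotaDl 1 0) -map_comp; apply: eq_map => i /=.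
by rewrite add1n expnS divnMA; congr (inord (_ %/ _ %% _)); case: b; lia.
Qed.

Lemma binary1 : binary 1 = [:: inord 1].
Proof. by rewrite /binary. Qed.

(** * The automaton and its reachable configurations *)

(* Row [q] lists the successors of state [q] on the digits 0 and 1. *)
Definition next_table : seq (nat * nat) :=
  [:: (0, 1); (2, 3); (4, 5); (6, 7); (8, 9); (10, 7); (11, 12); (13, 14);
      (4, 15); (16, 7); (5, 17); (18, 7); (19, 9); (20, 5); (21, 7); (22, 7);
      (23, 12); (24, 9); (11, 17); (12, 15); (25, 9); (26, 12); (15, 17);
      (27, 7); (17, 15); (20, 15); (28, 7); (23, 17); (26, 17)].

Definition out_table : seq (nat * nat) :=
  [:: (1, 1); (1, 1); (1, 1); (2, 1); (2, 1); (5, 2); (2, 1); (3, 1); (2, 1);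
      (8, 3); (5, 2); (2, 1); (7, 3); (3, 1); (3, 1); (13, 5); (8, 3); (8, 3);
      (2, 1); (7, 3); (3, 1); (3, 1); (13, 5); (8, 3); (8, 3); (3, 1); (3, 1);
      (8, 3); (3, 1)].

Definition next q (b : bool) :=
  let r := nth (0, 0) next_table q in if b then r.2 else r.1.

Definition out q := nth (1, 1) out_table q.

Lemma next_lt q b : next q b < 29.
Proof.
rewrite /next; have [q29|?] := ltnP q 29; last by rewrite nth_default //; case: b.
have /all_nthP : all (fun r => (r.1 < 29) && (r.2 < 29)) next_table by [].
by move=> /(_ (0, 0) q q29)/andP[? ?]; case: b.
Qed.

Lemma out_gt0 q : 0 < (out q).2.
Proof.
rewrite /out; have [q29|?] := ltnP q 29; last by rewrite nth_default.
by have /all_nthP : all (fun r => 0 < r.2) out_table by []; apply.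
Qed.

Definition out_alphabet : {fset rat} := [fset r in map ratio out_table]%fset.

Lemma out_in_alphabet (q : 'I_29) : ratio (out q) \in out_alphabet.
Proof. rewrite in_fset; apply: map_f; exact: mem_nth. Qed.

Definition cce_automaton : dfao 2 rat :=
  @DFAO 2 rat 'I_29 (fun q d => inord (next q (d == inord 1))) ord0 out_alphabet
    (fun q => [` out_in_alphabet q]%fset).

Definition state n : nat := dfao_run cce_automaton (binary n) : 'I_29.

Lemma cce_automaton_output n :
  dfao_output cce_automaton (binary n) = ratio (out (state n)).
Proof. by []. Qed.

Lemma inord_bit (b : bool) : (inord b == inord 1 :> 'I_2) = b.
Proof. by rewrite -val_eqE /= !inordK //; case: b. Qed.

Lemma state1 : state 1 = 1.
Proof. by rewrite /state binary1 /dfao_run /= eqxx inordK. Qed.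

Lemma state_next n (b : bool) : 0 < n -> state (b + n.*2) = next (state n) b.
Proof.
move=> n0; rewrite /state binary_rcons // /dfao_run foldl_rcons /=.
by rewrite inord_bit inordK ?next_lt.
Qed.

Lemma append_bits_gt0 a s : 0 < a -> 0 < append_bits a s.
Proof. by move=> a0; rewrite append_bitsE; lia. Qed.

Lemma state_append_bits a s : 0 < a ->
  state (append_bits a s) = foldl next (state a) s.
Proof.
move=> a0; elim/last_ind: s => // s b IH.
by rewrite /append_bits !foldl_rcons state_next ?IH // append_bits_gt0.
Qed.

(* The state after reading [n], together with [t_(n-1)] and [t_n]; the latter
   two determine the letters of [t] around position [n * 2 ^ k] at distance
   less than [2 ^ k]. *)
Definition config n := (state n, (thue_morse n.-1, thue_morse n)).

(** Follows from [t_(2n) = t_n], [t_(2n+1) = ~~ t_n] and [t_(2n-1) = ~~ t_(n-1)]. *)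
Definition next_config (x : nat * (bool * bool)) (b : bool) :=
  (next x.1 b, if b then (x.2.2, ~~ x.2.2) else (~~ x.2.1, x.2.2)).

Lemma config_next n (b : bool) : 0 < n ->
  config (b + n.*2) = next_config (config n) b.
Proof.
move=> n0; rewrite /config /next_config state_next //=.
have [h0 h1] := mu_image_thue_morse n.
have [_ h2] := mu_image_thue_morse n.-1.
case: b; rewrite ?add1n ?add0n /= ?h0 ?h1 //.
by rewrite (_ : n.*2.-1 = n.-1.*2.+1) ?h2 //; lia.
Qed.

(** The seed is [config 1]; [reachable_closed] confirms that twelve rounds reach a closed set. *)
Definition reachable : seq (nat * (bool * bool)) :=
  iter 12 (fun s => undup (s ++ [seq next_config x b | x <- s, b <- [:: false; true]]))
    [:: (1, (false, true))].

Lemma reachable_closed :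
  all (fun x => (next_config x false \in reachable) &&
                (next_config x true \in reachable)) reachable.
Proof. by vm_compute. Qed.

Lemma config_reachable n : 0 < n -> config n \in reachable.
Proof.
move=> n0; have [s -> _] := append_bits_one n0.
elim/last_ind: s => [|s b IH].
  rewrite /append_bits [foldl _ _ _]/= /config state1.
  by have -> : (thue_morse 1.-1, thue_morse 1) = (false, true) by []; vm_compute.
have s0 : 0 < append_bits 1 s by apply: append_bits_gt0.
rewrite /append_bits foldl_rcons -/(append_bits 1 s) config_next; last exact: s0.
have /allP h := reachable_closed; have /andP[h0 h1] := h _ IH.
by case: b; [exact: h1|exact: h0].
Qed.

(** * Verification for small, odd and even lengths *)

Definition t32 := iter 5 mu [:: false].

Lemma t32E : t32 = thue_morse_prefix 32.
Proof. by rewrite /t32 thue_morse_iter. Qed.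

Definition t64 := mu t32.

Lemma t64E : t64 = thue_morse_prefix 64.
Proof. by rewrite /t64 t32E thue_morse_fixed. Qed.

(** A leading 1 followed by at most five bits covers lengths 1 to 63; [w ++ w] contains every
    conjugate of [w]. *)
Lemma small_cce_check :
  all (fun k => all (fun s => let n := append_bits 1 s in
                              let w := take n t64 in
                              max_exponent_is (w ++ w) n n (out (foldl next 1 s)))
                  (bit_words k)) (iota 0 6).
Proof. by vm_compute. Qed.

Lemma take_thue_morse_prefix k n : k <= n ->
  take k (thue_morse_prefix n) = thue_morse_prefix k.
Proof.
by move=> kn; rewrite /thue_morse_prefix /mkseq -map_take take_iota (minn_idPl kn).
Qed.

Lemma cce_small n : 0 < n < 64 -> cce (thue_morse_prefix n) = ratio (out (state n)).
Proof.
move=> /andP[n0 n64]; have [s e sn] := append_bits_one n0.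
have s6 : size s < 6 by rewrite -(ltn_exp2l _ _ (isT : 1 < 2)); lia.
have /allP/(_ (size s)) := small_cce_check; rewrite mem_iota => /(_ s6).
move=> /allP/(_ s (mem_bit_words s)) /=; rewrite -e -state1 -state_append_bits // -e.
rewrite t64E take_thue_morse_prefix; last exact: ltnW.
set w := thue_morse_prefix n.
have sw : size w = n by apply: size_thue_morse_prefix.
apply: (@cce_window w 0); rewrite ?out_gt0 ?size_cat ?sw ?leq_addr //.
  move=> j jn; rewrite add0n /circ sw nth_cat sw; case: ltnP => h.
    by rewrite modn_small.
  by rewrite -{1}(subnK h) modnDr modn_small //; lia.
by move=> i p l iw pl ln _; right; split; lia.
Qed.

(* The 24 letters of [t] on either side of the junction of [t[0..n-1]] with
   itself, where the bits [s] are the last five of [n] and [x] is the pair of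
   letters of [t] at [n %/ 32 - 1] and [n %/ 32]. *)
Definition window (x : bool * bool) s :=
  take 24 (drop (8 + append_bits 0 s) (map (addb x.1) t32 ++ map (addb x.2) t32))
  ++ take 24 t32.

(* By [odd_junction_run] a factor across the junction of exponent > 7/3 has
   period at most 17, length at most 40, and at most 24 letters on each side. *)
Lemma odd_cce_check :
  all (fun x => all (fun s => let r := out (foldl next x.1 (rcons s true)) in
                              (7 * r.2 <= 3 * r.1) &&
                              max_exponent_is (window x.2 (rcons s true)) 17 40 r)
                  (bit_words 4)) reachable.
Proof. by vm_compute. Qed.

(** Automaton counterpart of the invariance of [cce] under [mu]: after five further bits, a digit 0
    leaves the output unchanged. *)
Lemma even_out_check :
  all (fun x => all (fun s => let q := foldl next x.1 s in out (next q false) == out q)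
                  (bit_words 5)) reachable.
Proof. by vm_compute. Qed.

Lemma size_window x s : size s = 5 -> size (window x s) = 48.
Proof.
move=> s5; have := append_bits_lt s; rewrite s5 /window => slt.
rewrite size_cat !size_take size_drop size_cat !size_map t32E.
by rewrite !size_thue_morse_prefix /=; case: ltnP; lia.
Qed.

Lemma nth_window a s j : 0 < a -> size s = 5 -> 24 <= append_bits a s -> j < 48 ->
  let n := append_bits a s in
  nth false (window (thue_morse a.-1, thue_morse a) s) j =
  circ false (thue_morse_prefix n) (n - 24 + j).
Proof.
move=> a0 s5 + j48 n; rewrite -/n => n24.
have := append_bits_lt s; have := append_bitsE a s; rewrite s5 -/n /window.
(* The two blocks of length 32 start at [32 * (a - 1)], so [n = 32 * a + b] has offset [32 + b] in
   them, and 24 letters earlier is [8 + b]. *)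
set b := append_bits 0 s => nE b32.
have sz : size t32 = 32 by rewrite t32E size_thue_morse_prefix.
have nt32 k : k < 32 -> nth false t32 k = thue_morse k.
  by move=> k32; rewrite t32E nth_mkseq.
have st : size (take 24 (drop (8 + b) (map (addb (thue_morse a.-1)) t32 ++
                                   map (addb (thue_morse a)) t32))) = 24.
  by rewrite size_take size_drop size_cat !size_map sz; case: ltnP; lia.
rewrite nth_cat st; case: ltnP => hj; last first.
  rewrite nth_take; last lia.
  rewrite nt32; last lia.
  have -> : n - 24 + j = n + (j - 24) by lia.
  by rewrite circ_thue_morse_right //; lia.
rewrite nth_take // nth_drop nth_cat size_map sz circ_thue_morse_left; last lia.
case: ltnP => h.
  rewrite (nth_map false) ?sz ?nt32 // -(@thue_morse_block 5) //.
  by congr thue_morse; lia.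
have h' : 8 + b + j - 32 < 32 by lia.
rewrite (nth_map false) ?sz ?nt32 // -(@thue_morse_block 5) //.
by congr thue_morse; lia.
Qed.

Lemma cce_odd n : 64 <= n -> odd n -> cce (thue_morse_prefix n) = ratio (out (state n)).
Proof.
move=> n64 on; have [a [s [a0 s4 e]]] := @append_bits_split 4 n./2 ltac:(lia).
have {}e : n = append_bits a (rcons s true).
  by rewrite /append_bits foldl_rcons -/(append_bits a s) -e -on odd_double_half.
have s5 : size (rcons s true) = 5 by rewrite size_rcons s4.
have := mem_bit_words s; rewrite s4 => sb.
have /allP/(_ _ (config_reachable a0))/allP/(_ s sb) := odd_cce_check.
rewrite /= -state_append_bits // -e => /andP[r73].
have sw : size (thue_morse_prefix n) = n by apply: size_thue_morse_prefix.
apply: (@cce_window _ (n - 24)); rewrite ?out_gt0 ?size_window ?sw //.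
- by lia.
- by move=> j j48; rewrite e nth_window -?e //; lia.
move=> i p l iln pl ln r.
have key : l * 3 <= 7 * p -> l * (out (state n)).2 <= (out (state n)).1 * p.
  by move: (out _) r73 => [x y] /=; nia.
have [il|il] := leqP (i + l) n.
  by left; apply: key; have := @circ_thue_morse_run n i p l _ _ r; lia.
have u2 : n - i <= p.*2.
  by apply: (@circ_thue_morse_run n i _ _ _ _ (run_sub _ _ r)); lia.
have v2 : i + l - n <= p.*2.
  by apply: (@circ_thue_morse_run n n _ _ _ _ (run_sub _ _ r)); lia.
(* Each side has length at most [2p <= 8], well inside the window. *)
have [p4|p4] := leqP p 4; first by right; split; lia.
have ini : i < n < i + l by lia.
have [lp|[up vp]] := odd_junction_run on ini ln p4 r.
  (* [2p + 4 <= 7p/3] once [p >= 12]; below that each side has length at most 22. *)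
  by have [p12|p12] := ltnP p 12; [right; split|left; apply: key]; lia.
(* [2p + 6 <= 7p/3] once [p >= 18]; at [p = 17] the length is at most 40. *)
by have [p18|p18] := ltnP p 18; [right; split|left; apply: key]; lia.
Qed.

Lemma cce_even n : 32 <= n ->
  cce (thue_morse_prefix n.*2) = cce (thue_morse_prefix n) /\
  out (state n.*2) = out (state n).
Proof.
move=> n32; split.
  have sw : size (thue_morse_prefix n) = n by apply: size_thue_morse_prefix.
  rewrite -thue_morse_fixed cce_mu //; first by rewrite -size_eq0 sw; lia.
  rewrite -[2%:R%R](divr1 2%:R%R) (_ : _ / 1 = ratio (2, 1))%R //.
  (* The square [t_1 t_2 = 11] gives exponent 2. *)
  apply: (@cce_ge _ false _ 1) => //; first by rewrite sw; lia.
  move=> j j2; have -> : j = 0 by lia.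
  by rewrite !circ_thue_morse_left; [by []|lia..].
have [a [s [a0 s5 e]]] := @append_bits_split 5 n ltac:(lia).
have := mem_bit_words s; rewrite s5 => sb.
have /allP/(_ _ (config_reachable a0))/allP/(_ s sb)/eqP ev := even_out_check.
have n0 : 0 < n by lia.
by rewrite -[n.*2]/(false + n.*2) state_next // e state_append_bits.
Qed.

Theorem theorem7 :
  exists M : dfao 2 rat,
    #|dfao_state M| = 29 /\
    forall n : nat, 1 <= n ->
      dfao_output M (binary n) = cce (thue_morse_prefix n).
Proof.
exists cce_automaton; split=> [|n n0]; first exact: card_ord.
rewrite cce_automaton_output; elim/ltn_ind: n n0 => n IH n0.
have [n64|n64] := ltnP n 64; first by rewrite cce_small ?n0.
case: (boolP (odd n)) => [on|en]; first by rewrite cce_odd.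
have [e1 e2] := @cce_even n./2 ltac:(lia).
rewrite even_halfK // in e1 e2; rewrite e1 e2; apply: IH; lia.
Qed.
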